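(* Let $n\ge 1$. There is a one-to-one correspondence between the families of spherical simplices generating the reflection group $A_n$ (families considered up to isometry) and the trees with $n+1$ vertices (considered up to isomorphism). The correspondence is given as follows: realize the family by unit normal vectors $\pm f_1,\dots,\pm f_n$ which, suitably normalized, lie in the root system $\Delta(A_n)=\{\pm(h_i-h_j): 0\le i<j\le n\}$, where $h_0,\dots,h_n$ is the standard basis of $\mathbb{R}^{n+1}$; the associated graph has vertices $v_0,\dots,v_n$ (corresponding to $h_0,\dots,h_n$), with $v_i$ and $v_j$ joined by an edge iff $\pm(h_i-h_j)$ is one of the $f_k$. The correspondence is well defined and is a bijection onto the set of trees with $n+1$ vertices.
   Context: A spherical simplex in $S^{m}\subset\mathbb{R}^{m+1}$ is determined by $m+1$ linearly independent unit vectors $f_1,\dots,f_{m+1}$ (outer normals to its facets). The $m+1$ hyperplanes $f_i^\perp$ cut $S^m$ into $2^{m+1}$ simplices, encoded by the vectors $\pm f_1,\dots,\pm f_{m+1}$; this set of simplices is called a family. All simplices of a family generate the same group, generated by the reflections in the hyperplanes $f_i^\perp$; a family generates a reflection group $G$ if this group is $G$ (up to conjugation by an orthogonal transformation). $A_n$ denotes the finite Coxeter (Weyl) group of type $A_n$, acting on the $n$-dimensional subspace $\{\sum x_i=0\}$ of $\mathbb{R}^{n+1}$, so the relevant simplices are $(n-1)$-dimensional. *)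

(* Defs.v *)
From HB Require Import structures.
From mathcomp Require Import all_boot all_order all_algebra all_fingroup.
From mathcomp Require Import boolp reals.
Set Implicit Arguments. Unset Strict Implicit. Unset Printing Implicit Defensive.
Import Order.TTheory GRing.Theory Num.Theory.
Local Open Scope ring_scope.

Section Defs.
Variable R : realType.
Variable n : nat.

Definition vec := 'rV[R]_(n.+1).

Definition inV (v : vec) : Prop := \sum_(i < n.+1) v 0 i = 0.

Definition Aroot (i j : 'I_(n.+1)) : vec := delta_mx 0 i - delta_mx 0 j.

(* reflection in the hyperplane f^perp, acting on row vectors by x |-> x *m refl f *)
Definition refl (f : vec) : 'M[R]_(n.+1) :=
  1%:M - (2 / (f *m f^T) 0 0) *: (f^T *m f).

(* the group generated by a set of (involutive) matrices: all finite products *)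
Definition gen_by (S : 'M[R]_(n.+1) -> Prop) (M : 'M[R]_(n.+1)) : Prop :=
  exists s : seq 'M[R]_(n.+1), (forall A, A \in s -> S A) /\ M = \prod_(A <- s) A.

Definition WA : 'M[R]_(n.+1) -> Prop :=
  gen_by (fun M => exists i j : 'I_(n.+1), i != j /\ M = refl (Aroot i j)).

(* orthogonal transformations of V (extended orthogonally to R^{n+1}) *)
Definition orthV (Q : 'M[R]_(n.+1)) : Prop :=
  Q *m Q^T = 1%:M /\ (forall v, inV v -> inV (v *m Q)).

(* a family of spherical simplices in the unit sphere of V:
   n linearly independent unit vectors f_1..f_n of V (the family is {+-f_k}) *)
Definition simplex_family (F : 'I_n -> vec) : Prop :=
  [/\ forall k, inV (F k),
      forall k, (F k *m (F k)^T) 0 0 = 1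
    & row_free (\matrix_(k < n) F k)].

Definition grp (F : 'I_n -> vec) : 'M[R]_(n.+1) -> Prop :=
  gen_by (fun M => exists k, M = refl (F k)).

Definition generatesA (F : 'I_n -> vec) : Prop :=
  exists Q, orthV Q /\
    forall M, grp F M <-> exists w, WA w /\ M = Q^T *m w *m Q.

Definition isometric (F G : 'I_n -> vec) : Prop :=
  exists Q, orthV Q /\ exists s : {perm 'I_n},
    forall k, exists e : R, (e = 1 \/ e = -1) /\ F k *m Q = e *: G (s k).

Definition root_family (F : 'I_n -> vec) : Prop :=
  forall k, exists i j : 'I_(n.+1), i != j /\ exists c : R, F k = c *: Aroot i j.

Definition assoc_graph (F : 'I_n -> vec) : rel 'I_(n.+1) :=
  fun i j => `[< i != j /\ exists k (c : R), F k = c *: Aroot i j >].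

End Defs.

Definition is_tree (T : finType) (e : rel T) : Prop :=
  [/\ forall x, ~~ e x x,
      forall x y, e x y = e y x,
      forall x y, connect e x y
    & forall c : seq T, uniq c -> (2 < size c)%N -> ~~ path.cycle e c].

Definition isomorphic (T : finType) (e1 e2 : rel T) : Prop :=
  exists s : {perm T}, forall x y, e1 x y = e2 (s x) (s y).

(* Main.v *)
(* A root family is a set of n edges on {0, .., n}. Linear independence of the
   roots forces this graph to be a tree: the vectors orthogonal to all edges are
   the functions constant on components, and a cycle is a linear relation.
   Conversely a connected family generates all transpositions, hence the Weyl
   group. A reflection in the Weyl group is a transposition, so conjugating a
   family that generates A_n into the Weyl group makes its normals proportional
   to roots. Finally, an isometry between two root families preserves the root
   lattice; its matrix columns are then, up to an additive constant, plus or
   minus basis vectors, so it induces a permutation of the vertices, which is a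
   graph isomorphism. *)
Require Import Defs.
From HB Require Import structures.
From mathcomp Require Import all_boot all_order all_algebra all_fingroup.
From mathcomp Require Import boolp reals.
From mathcomp Require Import ring lra.
Set Implicit Arguments. Unset Strict Implicit. Unset Printing Implicit Defensive.
Import Order.TTheory GRing.Theory Num.Theory.
Local Open Scope ring_scope.

Section RootFamilies.
Variables (R : realType) (n : nat).
Implicit Types (M : 'M[R]_n.+1) (v : vec R n) (i j : 'I_n.+1) (Q : 'M[R]_n.+1) (F G : 'I_n -> vec R n).

Local Notation ones := (const_mx 1 : 'cV[R]_n.+1).
Local Notation sqnorm v := ((v *m v^T) 0 0).

(** * The hyperplane V, norms and roots *)

Lemma inVE v : inV v <-> v *m ones = 0.
Proof.
have E : (v *m ones) 0 0 = \sum_i v 0 i.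
  by rewrite mxE; apply: eq_bigr => i _; rewrite !mxE mulr1.
split=> [h|h]; last by rewrite /inV -E h mxE.
by apply/matrixP => a b; rewrite !ord1 E h mxE.
Qed.

Lemma sqnormE v : sqnorm v = \sum_i v 0 i ^+ 2.
Proof. by rewrite mxE; apply: eq_bigr => i _; rewrite mxE expr2. Qed.

Lemma sqnormZ (c : R) v : sqnorm (c *: v) = c ^+ 2 * sqnorm v.
Proof. by rewrite linearZ /= -scalemxAl -scalemxAr scalerA mxE expr2. Qed.

Lemma sqnormM Q v : Q *m Q^T = 1%:M -> sqnorm (v *m Q) = sqnorm v.
Proof. by move=> h; rewrite trmx_mul mulmxA -(mulmxA v) h mulmx1. Qed.

Lemma ArootE i j c : Aroot R i j 0 c = (c == i)%:R - (c == j)%:R.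
Proof. by rewrite !mxE /=. Qed.

Lemma Aroot_mul p i j (B : 'M[R]_(n.+1, p)) : Aroot R i j *m B = row i B - row j B.
Proof. by rewrite mulmxBl -!rowE. Qed.

Lemma ArootN i j : Aroot R j i = - Aroot R i j.
Proof. by rewrite opprB. Qed.

Lemma Aroot_inV i j : inV (Aroot R i j).
Proof. by apply/inVE; rewrite Aroot_mul !row_const subrr. Qed.

Lemma sqnorm_Aroot i j : i != j -> sqnorm (Aroot R i j) = 2.
Proof.
move=> hij; rewrite Aroot_mul !mxE !eqxx /= [j == i]eq_sym (negPf hij) /=. lra.
Qed.

Lemma Aroot_scale_sq F k i j (c : R) :
  simplex_family F -> i != j -> F k = c *: Aroot R i j -> c ^+ 2 = 2^-1.
Proof.
case=> _ + _ hij hc => /(_ k); rewrite hc sqnormZ sqnorm_Aroot // => h.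
by apply: (mulIf (x := 2)); rewrite ?pnatr_eq0 // mulVf ?pnatr_eq0.
Qed.

Lemma Aroot_scale_neq0 F k i j (c : R) :
  simplex_family F -> i != j -> F k = c *: Aroot R i j -> c != 0.
Proof.
move=> sF hij hc.
by rewrite -sqrf_eq0 (Aroot_scale_sq sF hij hc) invr_eq0 pnatr_eq0.
Qed.

(** * Orthogonal transformations preserving V *)

(** V is the orthogonal complement of [ones], so an orthogonal map preserving V also preserves the
    line spanned by [ones]. Comparing norms leaves only a sign [l]. *)
Lemma orthV_ones Q : orthV Q ->
  exists l : R, [/\ l ^+ 2 = 1, Q *m ones = l *: ones & Q^T *m ones = l *: ones].
Proof.
case=> hQ hV.
have hQ' : Q^T *m Q = 1%:M by apply: mulmx1C.
pose l := (Q *m ones) ord0 0.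
have Ql : Q *m ones = l *: ones.
  apply/colP => i; rewrite [RHS]mxE [ones _ _]mxE mulr1 /l.
  have /hV/inVE := Aroot_inV i ord0; rewrite -mulmxA Aroot_mul => /rowP/(_ 0).
  by rewrite mxE [in X in X + _]mxE [in X in _ + X]mxE [in X in _ - X]mxE [RHS]mxE => /subr0_eq.
have l2 : l ^+ 2 = 1.
  have : (Q *m ones)^T *m (Q *m ones) = ones^T *m ones.
    by rewrite trmx_mul -mulmxA (mulmxA Q^T) hQ' mul1mx.
  rewrite Ql [(_ *: _)^T]linearZ /= -scalemxAl -scalemxAr scalerA => /matrixP/(_ 0 0).
  have -> : ones^T *m ones = (n.+1%:R)%:M.
    apply/matrixP => a b; rewrite !ord1 mxE [RHS]mxE eqxx mulr1n.
    rewrite (eq_bigr (fun=> 1)) ?sumr_const ?card_ord // => i _.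
    by rewrite !mxE mulr1.
  rewrite mxE [_%:M _ _]mxE eqxx mulr1n -expr2 => h.
  apply: (mulIf (x := n.+1%:R)); first by rewrite pnatr_eq0.
  by rewrite h mul1r.
exists l; split=> //.
have : Q^T *m (l *: (Q *m ones)) = l *: ones by rewrite -scalemxAr mulmxA hQ' mul1mx.
by rewrite Ql scalerA -expr2 l2 scale1r.
Qed.

Lemma orthV_tr Q : orthV Q -> orthV Q^T.
Proof.
move=> oQ; have [l [_ _ hl]] := orthV_ones oQ; case: oQ => hQ _.
split; first by rewrite trmxK; apply: mulmx1C.
by move=> v /inVE hv; apply/inVE; rewrite -mulmxA hl -scalemxAr hv scaler0.
Qed.

Lemma orthV_perm (s : {perm 'I_n.+1}) : orthV (perm_mx s : 'M[R]__).
Proof.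
split; first by rewrite tr_perm_mx -perm_mxM mulgV perm_mx1.
move=> v /inVE hv; apply/inVE; rewrite -mulmxA.
suff -> : perm_mx s *m ones = ones by [].
by rewrite -row_permE; apply/colP=> i; rewrite !mxE.
Qed.

Lemma Aroot_perm (s : {perm 'I_n.+1}) i j :
  Aroot R i j *m perm_mx s = Aroot R (s i) (s j).
Proof. by apply/rowP => c; rewrite Aroot_mul !mxE /= !(eq_sym c). Qed.

(** * Reflections *)

Lemma reflZ (c : R) v : c != 0 -> refl (c *: v) = refl v.
Proof.
move=> c0; rewrite /refl sqnormZ [(c *: v)^T]linearZ /= -scalemxAl -scalemxAr !scalerA.
congr (_ - _ *: _); rewrite invfM; by move: (sqnorm v)^-1 => t; field.
Qed.

Lemma refl_conj Q v : Q *m Q^T = 1%:M -> refl (v *m Q) = Q^T *m refl v *m Q.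
Proof.
move=> hQ; rewrite /refl sqnormM // mulmxBr mulmxBl mulmx1 (mulmx1C hQ).
by rewrite -scalemxAr -scalemxAl trmx_mul !mulmxA.
Qed.

Lemma refl_unit v : sqnorm v = 1 -> refl v = 1%:M - 2 *: (v^T *m v).
Proof. by rewrite /refl => ->; rewrite divr1. Qed.

Lemma refl_unitE v a b : sqnorm v = 1 -> refl v a b = (a == b)%:R - 2 * (v 0 a * v 0 b).
Proof.
by move=> hv; rewrite refl_unit // !mxE big_ord1 !mxE.
Qed.

Lemma refl_Aroot i j : i != j -> refl (Aroot R i j) = tperm_mx i j.
Proof.
move=> hij; rewrite /refl sqnorm_Aroot // divff ?pnatr_eq0 // scale1r.
apply/matrixP => a b; rewrite !mxE big_ord1 mxE !ArootE /=.
case: tpermP => [->|->|/eqP/negPf hai /eqP/negPf haj].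
- rewrite eqxx (negPf hij) (eq_sym i b) (eq_sym j b).
  by case: (b == i); case: (b == j) => /=; ring.
- rewrite eqxx (eq_sym j i) (negPf hij) (eq_sym i b) (eq_sym j b).
  by case: (b == i); case: (b == j) => /=; ring.
by rewrite hai haj; ring.
Qed.

Lemma gen_by_sub (S S' : 'M[R]_n.+1 -> Prop) M :
  (forall A, S A -> gen_by S' A) -> gen_by S M -> gen_by S' M.
Proof.
move=> h [s [hs ->]]; elim: s hs => [|A s IH] hs.
  by exists [::]; rewrite !big_nil.
rewrite big_cons.
have [t [ht ->]] := h A (hs A (mem_head _ _)).
case: IH => [B hB|u [hu ->]]; first by apply: hs; rewrite inE hB orbT.
exists (t ++ u); rewrite big_cat; split=> // B.
by rewrite mem_cat => /orP[/ht|/hu].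
Qed.

Lemma gen_by_mul (S : 'M[R]_n.+1 -> Prop) A B :
  gen_by S A -> gen_by S B -> gen_by S (A *m B).
Proof.
move=> [t [ht ->]] [u [hu ->]]; exists (t ++ u); rewrite big_cat; split=> // C.
by rewrite mem_cat => /orP[/ht|/hu].
Qed.

Lemma gen_by_one (S : 'M[R]_n.+1 -> Prop) A : S A -> gen_by S A.
Proof.
move=> hA; exists [:: A]; rewrite big_seq1; split=> // B.
by rewrite inE => /eqP->.
Qed.

Lemma WA_perm M : WA M -> exists s : {perm 'I_n.+1}, M = perm_mx s.
Proof.
case=> t [ht ->]; elim: t ht => [|A t IH] ht.
  by exists 1%g; rewrite big_nil perm_mx1.
have [i [j [hij ->]]] := ht A (mem_head _ _).
case: IH => [B hB|s hs]; first by apply: ht; rewrite inE hB orbT.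
by exists (tperm i j * s)%g; rewrite big_cons hs refl_Aroot // perm_mxM.
Qed.

(* The entries of refl v are 0 or 1, so that v_a^2 is 0 or 1/2 and v_a v_b is
   0 or -1/2 for a != b: only two coordinates of v can be nonzero. *)
Lemma refl_WA_Aroot v : inV v -> sqnorm v = 1 -> WA (refl v) ->
  exists i j, i != j /\ v = v 0 i *: Aroot R i j.
Proof.
move=> hV h1 /WA_perm [s hs].
have E a b : (a == b)%:R - 2 * (v 0 a * v 0 b) = (s a == b)%:R :> R.
  by rewrite -refl_unitE // hs !mxE.
have sq a : v 0 a != 0 -> v 0 a ^+ 2 = 2^-1.
  move=> h; have := E a a; rewrite eqxx; case: (s a == a) => /= e.
    by case/eqP: h; apply/eqP; rewrite -sqrf_eq0 expr2; apply/eqP; lra.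
  by rewrite expr2; lra.
have opp a b : a != b -> v 0 a != 0 -> v 0 b != 0 -> v 0 b = - v 0 a.
  move=> hab ha hb; have := E a b; rewrite (negPf hab).
  have hab0 : v 0 a * v 0 b != 0 by rewrite mulf_neq0.
  case: (s a == b) => /= e; last by case/eqP: hab0; lra.
  by apply: (mulfI ha); rewrite mulrN -expr2 (sq a ha); lra.
have [i hi] : exists i, v 0 i != 0.
  apply/existsP; apply: contra_eqT h1 => /existsPn h.
  rewrite sqnormE big1 ?(eq_sym 0) ?oner_eq0 // => i _.
  by have /negPn/eqP -> := h i; rewrite expr0n.
have [j hji hj] : exists2 j, j != i & v 0 j != 0.
  apply/exists_inP; apply: contra_neqT hi => /exists_inPn h.
  move: hV; rewrite /inV (bigD1 i) //= big1 ?addr0 // => j /h.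
  by move/negPn/eqP.
have hij : i != j by rewrite eq_sym.
exists i, j; split=> //; apply/rowP => c; rewrite mxE ArootE.
have [->|hci] := eqVneq c i; first by rewrite (negPf hij) subr0 mulr1.
have [->|hcj] := eqVneq c j; first by rewrite (opp i j) // sub0r mulrN1.
rewrite subr0 mulr0; apply/eqP; apply: contraT => hc.
have := opp i c; rewrite eq_sym => /(_ hci hi hc) ci.
have := opp j c; rewrite eq_sym => /(_ hcj hj hc) cj.
have ji := opp i j hij hi hj.
by case/eqP: hi; lra.
Qed.

(** Undoing the conjugation by [Q] gives the family [F k *m Q^T]. Its reflections lie in the Weyl
    group itself, so its normals are multiples of roots. *)
Lemma realization F : simplex_family F -> generatesA F ->
  exists G, [/\ simplex_family G, root_family G & isometric F G].
Proof.
case=> FV F1 Ffree [Q [oQ hQ]].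
have oQt := orthV_tr oQ; have [QQ VQ] := oQ; have [QQt VQt] := oQt.
rewrite trmxK in QQt.
have Gsq k : sqnorm (F k *m Q^T) = 1 by rewrite sqnormM ?trmxK.
exists (fun k => F k *m Q^T); split.
- split=> // [k|]; first exact: VQt.
  have -> : \matrix_k (F k *m Q^T) = (\matrix_k F k) *m Q^T.
    by apply/row_matrixP => k; rewrite rowK row_mul rowK.
  by rewrite /row_free mxrankMfree // row_free_unit; case: (mulmx1_unit QQ).
- move=> k; have [w [hw E]] : exists w, WA w /\ refl (F k) = Q^T *m w *m Q.
    by apply/hQ/gen_by_one; exists k.
  case: (@refl_WA_Aroot (F k *m Q^T)) => [|//||i [j [hij h]]].
  + exact: VQt.
  + rewrite refl_conj ?trmxK // E !mulmxA QQ mul1mx -mulmxA QQ mulmx1 //.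
  by exists i, j; split=> //; exists ((F k *m Q^T) 0 i).
exists Q^T; split=> //; exists 1%g => k; exists 1; split; first by left.
by rewrite perm1 scale1r.
Qed.

(** * Trees *)

Lemma assoc_graph_irr F i : ~~ assoc_graph F i i.
Proof. by apply/negP => /asboolP[/eqP]. Qed.

Lemma assoc_graph_sym F i j : assoc_graph F i j = assoc_graph F j i.
Proof.
apply/asboolP/asboolP => -[h [k [c hc]]]; rewrite eq_sym; split=> //;
  by exists k, (- c); rewrite hc ArootN scalerN scaleNr.
Qed.

Lemma assoc_graph_connect_sym F : connect_sym (assoc_graph F).
Proof. exact/sym_connect_sym/assoc_graph_sym. Qed.

Lemma root_family_edge F k : root_family F ->
  exists i j c, [/\ i != j, F k = c *: Aroot R i j & assoc_graph F i j].
Proof.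
move=> /(_ k) [i [j [hij [c hc]]]]; exists i, j, c; split=> //.
by apply/asboolP; split=> //; exists k, c.
Qed.

Lemma ones_tr_neq0 : ones^T != 0.
Proof. by apply/eqP => /rowP/(_ 0); rewrite !mxE => /eqP; rewrite oner_eq0. Qed.

(** By rank, the common kernel of the n independent normals is a line; it contains [ones]. *)
Lemma simplex_ker F (u : 'cV[R]_n.+1) :
  simplex_family F -> (forall k, F k *m u = 0) -> exists m, u = m *: ones.
Proof.
case=> FV _ Ffree hu; set X := \matrix_k F k in Ffree.
have ker (w : 'cV[R]_n.+1) : (forall k, F k *m w = 0) -> (w^T <= kermx X^T)%MS.
  move=> hw; apply/sub_kermxP; rewrite -trmx_mul.
  suff -> : X *m w = 0 by rewrite trmx0.
  by apply/row_matrixP => k; rewrite row_mul rowK hw row0.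
have [_ E] := mxrank_leqif_eq (ker ones (fun k => (inVE (F k)).1 (FV k))).
have : (u^T <= ones^T)%MS.
  apply: submx_trans (ker u hu) _.
  suff /andP[] : (ones^T == kermx X^T)%MS by [].
  by rewrite -E rank_rV ones_tr_neq0 mxrank_ker mxrank_tr (eqP Ffree) subSnn.
case/sub_rVP => m hm; exists m.
by apply: trmx_inj; rewrite hm linearZ.
Qed.

Lemma assoc_graph_connected F : simplex_family F -> root_family F ->
  forall x y, connect (assoc_graph F) x y.
Proof.
move=> sF rF x y; have csym := assoc_graph_connect_sym F.
(* The indicator of the component of [x] is killed by every edge, hence constant, and it is 1 at
   [x]. *)
pose u : 'cV[R]_n.+1 := \col_i (connect (assoc_graph F) x i)%:R.
have [k|m hm] := simplex_ker (u := u) sF.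
  have [i [j [c [hij -> e]]]] := root_family_edge k rF.
  rewrite -scalemxAl Aroot_mul; apply/rowP => a; rewrite !mxE.
  by rewrite !(csym x) (same_connect1 csym e) subrr mulr0.
have := congr1 (fun w : 'cV[R]_n.+1 => w x 0) hm.
have := congr1 (fun w : 'cV[R]_n.+1 => w y 0) hm.
rewrite !mxE connect0 => <-.
by case: connect => // /eqP; rewrite oner_eq0.
Qed.

(** Let [F k] be the edge from [x] to [y] on a cycle, and [u] a dual vector pairing to 1 with [F k]
    and to 0 with every other normal. Then [u] is constant along the rest of the cycle, so it agrees
    at [x] and [y] and pairs to 0 with [F k], a contradiction. *)
Lemma assoc_graph_acyclic F : simplex_family F ->
  forall c, uniq c -> (2 < size c)%N -> ~~ path.cycle (assoc_graph F) c.
Proof.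
move=> sF [|x [|y [|z p]]] // /andP[xp] /andP[yp _] _; apply/negP.
rewrite /= rcons_path => /and4P[/asboolP[hxy [k [c hk]]]].
have [_ _ /row_freeP[B hB]] := sF.
pose u := col k B.
have Fu l : (F l *m u) 0 0 = (l == k)%:R.
  have := congr1 (fun A : 'M_n => A l k) hB; rewrite [RHS]mxE => <-.
  by rewrite !mxE; apply: eq_bigr => a _; rewrite !mxE.
(* A vertex [w] in the support of [F k] but off the edge [a b] certifies that this edge is not
   [F k]. The witness is [x] on the path from [y] to the last vertex, and [y] on the closing
   edge. *)
have step w a b : F k 0 w != 0 -> w != a -> w != b -> assoc_graph F a b -> u a 0 = u b 0.
  move=> hw hwa hwb /asboolP[hab [l [d hl]]].
  have lk : l != k.
    apply: contraNneq hw => <-.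
    by rewrite hl mxE ArootE (negPf hwa) (negPf hwb) subrr mulr0.
  have := Fu l; rewrite (negPf lk) hl -scalemxAl mxE Aroot_mul !mxE => /eqP.
  by rewrite mulf_eq0 (negPf (Aroot_scale_neq0 sF hab hl)) subr_eq0 => /eqP.
have c0 := Aroot_scale_neq0 sF hxy hk.
have Fkx : F k 0 x != 0 by rewrite hk mxE ArootE eqxx (negPf hxy) subr0 mulr1.
have Fky : F k 0 y != 0.
  by rewrite hk mxE ArootE eqxx [y == x]eq_sym (negPf hxy) sub0r mulrN1 oppr_eq0.
move=> yz zp lx.
have along q a : x \notin a :: q -> path (assoc_graph F) a q -> u a 0 = u (last a q) 0.
  elim: q a => //= b q IH a; rewrite !inE !negb_or => /and3P[ha hb hq] /andP[ab bq].
  by rewrite (step x a b) //; apply: IH; rewrite // inE negb_or hb.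
have uxy : u y 0 = u x 0.
  rewrite (along (z :: p)) //=; last by rewrite yz.
  apply: (step y) => //; last by rewrite eq_sym.
  by apply: contraNneq yp => ->; rewrite mem_last.
have := Fu k; rewrite eqxx hk -scalemxAl mxE Aroot_mul !mxE.
by move: uxy; rewrite !mxE => -> /eqP; rewrite subrr mulr0 eq_sym oner_eq0.
Qed.

Lemma assoc_graph_tree F : simplex_family F -> root_family F -> is_tree (assoc_graph F).
Proof.
move=> sF rF; split.
- exact: assoc_graph_irr.
- exact: assoc_graph_sym.
- exact: assoc_graph_connected.
- exact: assoc_graph_acyclic.
Qed.

(* Along a path i, i', .., j the transposition (i j) is the conjugate of (i' j) by (i i'). *)
Lemma simplex_root_generatesA F : simplex_family F -> root_family F -> generatesA F.
Proof.
move=> sF rF; exists 1%:M; split.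
  by split=> [|v]; rewrite ?trmx1 mulmx1.
have edge i j : assoc_graph F i j -> grp F (tperm_mx i j).
  case/asboolP=> hij [k [c hc]]; apply: gen_by_one; exists k.
  rewrite hc reflZ ?refl_Aroot //.
  by apply: Aroot_scale_neq0 hc.
have transp i j : i != j -> grp F (tperm_mx i j).
  have /connectP[p] := assoc_graph_connected sF rF i j.
  elim: p i => [|i' p IH] i /=; first by move=> _ ->; rewrite eqxx.
  move=> /andP[e hp] hj hij; have [<-|hi'j] := eqVneq i' j; first exact: edge.
  rewrite /tperm_mx; have -> : tperm i j = (tperm i i' * (tperm i' j * tperm i i'))%g.
    by rewrite -{1}[tperm i i']tpermV -/(conjg _ _) tpermJ tpermR tpermD // eq_sym.
  rewrite !perm_mxM; apply: gen_by_mul; first exact: edge.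
  by apply: gen_by_mul; [apply: IH | apply: edge].
move=> M; rewrite trmx1; split=> [hM|[w [hw ->]]].
  exists M; rewrite mul1mx mulmx1; split=> //.
  apply: gen_by_sub hM => _ [k ->].
  have [i [j [c [hij hc _]]]] := root_family_edge k rF.
  rewrite hc reflZ; first by apply: gen_by_one; exists i, j.
  by apply: Aroot_scale_neq0 hc.
rewrite mul1mx mulmx1; apply: gen_by_sub hw => _ [i [j [hij ->]]].
by rewrite refl_Aroot //; apply: transp.
Qed.

Lemma rowsub_free_of_rank (m p r : nat) (A : 'M[R]_(m, p)) :
  \rank A = r -> exists f : 'I_r -> 'I_m, row_free (rowsub f A).
Proof. by move=> <-; exists (maxrankfun A); apply: maxrowsub_free. Qed.

Lemma rank_ker_ones (m : nat) (E : 'M[R]_(m, n.+1)) :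
  E *m ones = 0 -> (forall u : 'cV_n.+1, E *m u = 0 -> exists a, u = a *: ones) ->
  \rank E = n.
Proof.
move=> E1 Eker.
have : \rank (kermx E^T) = 1%N.
  suff /eqmxP -> : (kermx E^T == ones^T)%MS by rewrite rank_rV ones_tr_neq0.
  apply/andP; split; last by apply/sub_kermxP; rewrite -trmx_mul E1 trmx0.
  apply/row_subP => a; set r := row _ _.
  have /sub_kermxP hr : (r <= kermx E^T)%MS by apply: row_sub.
  have [|b hb] := Eker r^T; first by apply: trmx_inj; rewrite trmx_mul trmxK hr trmx0.
  by apply/sub_rVP; exists b; apply: trmx_inj; rewrite hb linearZ /= trmxK.
rewrite mxrank_ker mxrank_tr => h.
by rewrite -(subKn (rank_leq_col E)) h subn1.
Qed.

(* A maximal independent set of edges of T is connected, and the remaining edges would close cycles. *)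
Lemma tree_realized (T : rel 'I_n.+1) : is_tree T ->
  exists F, [/\ simplex_family F, root_family F & assoc_graph F =2 T].
Proof.
case=> Tirr Tsym Tconn Tacyc.
pose d : R := (Num.sqrt 2)^-1.
have d2 : d ^+ 2 = 2^-1 by rewrite exprVn sqr_sqrtr // ler0n.
have d0 : d != 0 by rewrite -sqrf_eq0 d2 invr_eq0 pnatr_eq0.
(* There is one row for each ordered pair of vertices, zero on non-edges. As [T] is connected, the
   kernel is the line of constants, whence rank n. *)
pose E := \matrix_(a < #|{: 'I_n.+1 * 'I_n.+1}|)
  (if T (enum_val a).1 (enum_val a).2
   then d *: Aroot R (enum_val a).1 (enum_val a).2 else 0).
have rE : \rank E = n.
  apply: rank_ker_ones.
    apply/row_matrixP => a; rewrite row_mul rowK row0.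
    case: ifP => _; last by rewrite mul0mx.
    by rewrite -scalemxAl (inVE _).1 ?scaler0 //; apply: Aroot_inV.
  move=> u hu; exists (u 0 0).
  have step a b : T a b -> u a 0 = u b 0.
    move=> Tab; have := congr1 (row (enum_rank (a, b))) hu.
    rewrite row_mul rowK enum_rankK /= Tab row0 -scalemxAl Aroot_mul => /rowP/(_ 0).
    by rewrite !mxE => /eqP; rewrite mulf_eq0 (negPf d0) subr_eq0 => /eqP.
  apply/colP => a; rewrite !mxE mulr1.
  have /connectP[p] := Tconn 0 a; elim: p 0 => [|c p IH] b /=; first by move=> _ ->.
  by move=> /andP[/step ->] hp ha; apply: IH.
have [f ffree] := rowsub_free_of_rank rE.
pose F k := row (f k) E.
have FX : \matrix_k F k = rowsub f E.
  by apply/row_matrixP => k; rewrite rowK row_rowsub.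
(* Independent rows are nonzero, so the selected ones come from edges of [T]. *)
have Fedge k : exists i j, T i j /\ F k = d *: Aroot R i j.
  have : F k != 0.
    have [B hB] := row_freeP ffree; apply/eqP => Fk0.
    have := congr1 (row k) hB; rewrite row_mul row_rowsub -/(F k) Fk0 mul0mx.
    by move/rowP/(_ k); rewrite !mxE eqxx => /eqP; rewrite eq_sym oner_eq0.
  rewrite /F rowK; case: ifP => [hT _|]; last by rewrite eqxx.
  by do 2!eexists; split; first exact: hT.
have Tneq i j : T i j -> i != j by apply: contraTneq => ->; apply: Tirr.
have sF : simplex_family F.
  split=> [k|k|]; last by rewrite FX.
    have [i [j [_ ->]]] := Fedge k.
    by apply/inVE; rewrite -scalemxAl (inVE _).1 ?scaler0 //; apply: Aroot_inV.
  have [i [j [/Tneq hij ->]]] := Fedge k.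
  by rewrite sqnormZ sqnorm_Aroot // d2 mulVf ?pnatr_eq0.
have rF : root_family F.
  by move=> k; have [i [j [/Tneq hij ->]]] := Fedge k; exists i, j; split=> //; exists d.
have sub i j : assoc_graph F i j -> T i j.
  case/asboolP=> hij [k [c hc]]; have [a [b [Tab]]] := Fedge k.
  rewrite hc => /rowP h.
  have c0 := Aroot_scale_neq0 sF hij hc.
  (* The support of a nonzero multiple of a root determines the edge up to orientation. *)
  have supp w : (w == i) || (w == j) -> (w == a) || (w == b).
    move=> hw; apply: contraT; rewrite negb_or => /andP[wa wb].
    have := h w; rewrite !mxE /= (negPf wa) (negPf wb) subrr mulr0 => /eqP.
    rewrite mulf_eq0 (negPf c0) /=.
    case/orP: hw => /eqP->; rewrite eqxx ?(negPf hij) ?[j == i]eq_sym ?(negPf hij).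
      by rewrite subr0 oner_eq0.
    by rewrite sub0r oppr_eq0 oner_eq0.
  have := supp i; have := supp j; rewrite !eqxx orbT => /(_ isT) hj /(_ isT) hi.
  case/orP: hi hij => /eqP->; case/orP: hj => /eqP->; rewrite ?eqxx // => _.
  by rewrite Tsym.
exists F; split=> // i j; apply/idP/idP => [/sub //|Tij]; apply: contraT => nF.
have /connectP[p0 /shortenP[p hp up _] jp] := assoc_graph_connected sF rF i j.
have hT : path T i p by apply: sub_path hp => a b /sub.
suff /(Tacyc _ up) : (2 < size (i :: p))%N.
  by rewrite /= rcons_path hT -jp Tsym Tij.
case: p hp jp {up hT} => [_ /= ji|a [|b p]] //=.
  by rewrite ji (negPf (Tirr _)) in Tij.
by rewrite andbT => e ja; rewrite ja e in nF.
Qed.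

(** * Isometric families *)

Lemma simplex_scale_inj F k l (a : R) : simplex_family F -> F k = a *: F l -> k = l.
Proof.
case=> _ _ /row_freeP[B hB] h.
have FB m : (F m *m B) 0 k = (m == k)%:R.
  have := congr1 (fun A : 'M_n => A m k) hB; rewrite [RHS]mxE => <-.
  by rewrite !mxE; apply: eq_bigr => b _; rewrite !mxE.
have := FB k; rewrite h -scalemxAl mxE FB eqxx; have [//|_ /eqP] := eqVneq l k.
by rewrite mulr0 eq_sym oner_eq0.
Qed.

(** The permutation matrix of the graph isomorphism is the isometry. Unit length fixes the square of
    the factor in front of each root, so matching normals agree up to sign. *)
Lemma isomorphic_isometric F G :
  simplex_family F -> root_family F -> simplex_family G ->
  isomorphic (assoc_graph F) (assoc_graph G) -> isometric F G.
Proof.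
move=> sF rF sG [s hs]; exists (perm_mx s); split; first exact: orthV_perm.
have img k : exists l, exists e : R, (e = 1 \/ e = -1) /\ F k *m perm_mx s = e *: G l.
  have [i [j [c [hij hc]]]] := root_family_edge k rF.
  rewrite hs => /asboolP[hsij [l [d hd]]]; exists l.
  rewrite hc -scalemxAl Aroot_perm hd.
  have /eqP : c ^+ 2 = d ^+ 2 by rewrite (Aroot_scale_sq sF hij hc) (Aroot_scale_sq sG hsij hd).
  rewrite eqf_sqr => /orP[] /eqP ->; [exists 1|exists (-1)]; split; auto.
    by rewrite scale1r.
  by rewrite scalerA mulN1r.
have [f hf] := choice img.
have f_inj : injective f.
  move=> k l fkl; have [e [he hk]] := hf k; have [e' [he' hl]] := hf l.
  rewrite -fkl in hl.
  have e'2 : e' * e' = 1 by case: he' => ->; ring.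
  apply: (@simplex_scale_inj F _ _ (e * e')) => //.
  have [PP _] := orthV_perm s.
  rewrite -[F k]mulmx1 -[F l]mulmx1 -PP !mulmxA hk hl.
  by rewrite -!scalemxAl !scalerA -mulrA e'2 mulr1.
by exists (perm f_inj) => k; rewrite permE.
Qed.

(* With S the set where g exceeds its minimum, the two sums give
   #|S|^2 - (n + 1) #|S| + n = 0, i.e. S or its complement is a singleton. *)
Lemma almost_constant (g : 'I_n.+1 -> R) (l : R) : (1 <= n)%N ->
  l ^+ 2 = 1 -> \sum_i g i = l -> \sum_i g i ^+ 2 = 1 ->
  (forall i j, [\/ g i - g j = 0, g i - g j = 1 | g i - g j = -1]) ->
  exists t (eps : R), (eps = 1 \/ eps = -1 /\ (1 < n)%N) /\
    forall i j, g i - g j = eps * ((i == t)%:R - (j == t)%:R).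
Proof.
move=> hn l2 sum1 sum2 dg.
have [i0 _ i0min] := arg_minP g (erefl : xpredT (ord0 : 'I_n.+1)).
pose S := [set i | g i != g i0].
(* Minimality of [g i0] excludes the difference -1. *)
have gS i : g i = g i0 + (i \in S)%:R.
  have := i0min i isT; rewrite inE.
  by case: (dg i i0) => h; have [->|hne] /= := eqVneq (g i) (g i0); lra.
have sumS : \sum_i (i \in S)%:R = #|S|%:R :> R.
  by rewrite -natr_sum -big_mkcond /= sum1_card.
have cst (a : R) : \sum_(i < n.+1) a = n.+1%:R * a by rewrite sumr_const card_ord mulr_natl.
set s : R := #|S|%:R in sumS; set N : R := n.+1%:R in cst.
have E1 : N * g i0 + s = l by rewrite -sum1 (eq_bigr _ (fun i _ => gS i)) big_split /= cst sumS.
have E2 : N * g i0 ^+ 2 + (2 * g i0 + 1) * s = 1.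
  rewrite -[RHS]sum2 -cst -sumS mulr_sumr -big_split /=; apply: eq_bigr => i _.
  by rewrite (gS i); case: (i \in S) => /=; ring.
have : (s - 1) * (s - n%:R) = 0.
  have hN : N = n%:R + 1 by rewrite /N -natr1.
  (* Multiplying [E2] by [N] and substituting the square of [E1] eliminates [g i0]. *)
  have : l ^+ 2 - s ^+ 2 + N * s = N.
    by rewrite -[RHS]mulr1 -E2 -E1; ring.
  by rewrite l2 hN => h; rewrite -[RHS](subrr (n%:R + 1)) -{2}h; ring.
move/eqP; rewrite mulf_eq0 !subr_eq0 => cS.
(* For n = 1 both [S] and its complement are singletons; testing [S] first confines the sign -1 to n
   > 1. *)
have [S1|nS1] := eqVneq #|S| 1%N.
  have /cards1P[t ht] : #|S| == 1%N by rewrite S1.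
  exists t, 1; split; first by left.
  by move=> i j; rewrite (gS i) (gS j) ht !inE; ring.
have Sn : #|S| = n.
  by case/orP: cS; rewrite /s ?pnatr_eq1 ?eqr_nat => /eqP // h; rewrite h in nS1.
have /cards1P[t ht] : #|~: S| == 1%N.
  by rewrite -(eqn_add2l #|S|) cardsC card_ord Sn addn1.
exists t, (-1); split.
  by right; split=> //; rewrite ltn_neqAle hn -Sn eq_sym nS1.
have gt i : (i \in S) = (i != t) by rewrite -in_setC1 -ht setCK.
move=> i j; rewrite (gS i) (gS j) !gt.
by case: (i == t); case: (j == t) => /=; ring.
Qed.

(** The factors on both sides have equal squares; a remaining sign is absorbed by exchanging [a] and
    [b]. *)
Lemma isometric_root F G k i j (c : R) Q (s : {perm 'I_n}) (e : R) :
  simplex_family F -> simplex_family G -> root_family G ->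
  (e = 1 \/ e = -1) -> F k *m Q = e *: G (s k) -> i != j -> F k = c *: Aroot R i j ->
  exists a b, Aroot R i j *m Q = Aroot R a b.
Proof.
move=> sF sG rG he hk hij hc; have [a [b [d [hab hd _]]]] := root_family_edge (s k) rG.
have c2 := Aroot_scale_sq sF hij hc.
have c0 := Aroot_scale_neq0 sF hij hc.
have : (e * d) ^+ 2 = c ^+ 2.
  by rewrite c2 exprMn (Aroot_scale_sq sG hab hd); case: he => ->; ring.
have E : c *: (Aroot R i j *m Q) = (e * d) *: Aroot R a b.
  by rewrite scalemxAl -hc hk hd scalerA.
move/eqP; rewrite eqf_sqr => /orP[] /eqP h; rewrite h in E.
  by exists a, b; apply: (scalerI c0).
by exists b, a; apply: (scalerI c0); rewrite E (ArootN a b) scalerN scaleNr.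
Qed.

Lemma int_sqr_le2 (x : R) : x \is a Num.int -> x ^+ 2 <= 2 ->
  [\/ x = 0, x = 1 | x = -1].
Proof.
move=> hx h2.
have [->|x0] := eqVneq x 0; first by constructor 1.
have [->|x1] := eqVneq x 1; first by constructor 2.
have [->|x2] := eqVneq x (-1); first by constructor 3.
have p1 : 1 <= (x - 1) ^+ 2 by apply: sqr_intr_ge1; rewrite ?subr_eq0 // rpredB // int_num1.
have p2 : 1 <= (x + 1) ^+ 2.
  by apply: sqr_intr_ge1; rewrite ?addr_eq0 // rpredD // int_num1.
have p0 : 0 < x ^+ 2 by rewrite exprn_even_gt0.
have [h|h] := leP 0 x; nra.
Qed.

(* Q preserves the root lattice, which the roots of a connected family span;
   hence it sends roots to integral vectors of squared norm 2. *)
Lemma isometric_diff F G Q (s : {perm 'I_n}) :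
  simplex_family F -> root_family F -> simplex_family G -> root_family G -> orthV Q ->
  (forall k, exists e : R, (e = 1 \/ e = -1) /\ F k *m Q = e *: G (s k)) ->
  forall c i j, [\/ Q i c - Q j c = 0, Q i c - Q j c = 1 | Q i c - Q j c = -1].
Proof.
move=> sF rF sG rG [QQ _] hQ c i j.
have [->|hij] := eqVneq i j; first by rewrite subrr; constructor 1.
have E : Q i c - Q j c = (Aroot R i j *m Q) 0 c by rewrite Aroot_mul !mxE.
rewrite E; apply: int_sqr_le2; last first.
  rewrite -(sqnorm_Aroot hij) -(sqnormM (Aroot R i j) QQ) sqnormE (bigD1 c) //=.
  by rewrite lerDl sumr_ge0 // => a _; rewrite sqr_ge0.
rewrite -E; have /connectP[p] := assoc_graph_connected sF rF i j.
elim: p i {hij E} => [|i' p IH] i /=; first by move=> _ ->; rewrite subrr int_num0.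
move=> /andP[/asboolP[hii' [k [d hd]]] hp] hj.
have -> : Q i c - Q j c = (Q i c - Q i' c) + (Q i' c - Q j c) by ring.
rewrite rpredD ?IH //; have [e [he hk]] := hQ k.
have [a [b hab]] := isometric_root sF sG rG he hk hii' hd.
have -> : Q i c - Q i' c = (Aroot R i i' *m Q) 0 c by rewrite Aroot_mul !mxE.
by rewrite hab ArootE rpredB // natr_int.
Qed.

(* Up to sign and up to translation along V^perp, an orthogonal map preserving
   the root lattice permutes the h_i. *)
Lemma orthV_Aroot Q : (1 <= n)%N -> orthV Q ->
  (forall c i j, [\/ Q i c - Q j c = 0, Q i c - Q j c = 1 | Q i c - Q j c = -1]) ->
  exists tau : {perm 'I_n.+1}, forall i j, exists2 eta : R,
    eta != 0 & Aroot R i j *m Q = eta *: Aroot R (tau i) (tau j).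
Proof.
move=> hn oQ dQ; have [l [l2 _ Ql]] := orthV_ones oQ; have [QQ QV] := oQ.
(* Column [c] of [Q] is constant except at row [t c], where it deviates by [eps c]. *)
have col c : exists te : 'I_n.+1 * R, (te.2 = 1 \/ te.2 = -1 /\ (1 < n)%N) /\
    forall i j, Q i c - Q j c = te.2 * ((i == te.1)%:R - (j == te.1)%:R).
  have [||t [eps h]] := @almost_constant (Q ^~ c) l hn l2 _ _ (dQ c).
  - have := congr1 (fun w : 'cV[R]_n.+1 => w c 0) Ql; rewrite !mxE mulr1 => <-.
    by apply: eq_bigr => i _; rewrite !mxE mulr1.
  - have := congr1 (fun A : 'M[R]_n.+1 => A c c) (mulmx1C QQ).
    rewrite !mxE eqxx => h; apply: etrans h.
    by apply: eq_bigr => i _; rewrite !mxE expr2.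
  by exists (t, eps).
have [te hte] := choice col.
pose t c := (te c).1; pose eps c := (te c).2.
have AQ i j c : (Aroot R i j *m Q) 0 c = eps c * ((i == t c)%:R - (j == t c)%:R).
  by rewrite Aroot_mul !mxE (hte c).2.
have eps2 c : eps c ^+ 2 = 1.
  by rewrite /eps; case: (hte c).1 => [->|[-> _]]; ring.
(* [m i] counts the columns whose exceptional row is [i]; the squared norm 2 of the image of a root
   gives [m2]. *)
pose m i : R := \sum_c (i == t c)%:R.
have m2 i j : i != j -> m i + m j = 2.
  move=> hij; rewrite -(sqnorm_Aroot hij) -(sqnormM (Aroot R i j) QQ) sqnormE.
  rewrite -big_split /=; apply: eq_bigr => c _; rewrite AQ exprMn eps2 mul1r.
  have [<-|_] := eqVneq i (t c); last by case: (j == t c) => /=; ring.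
  by rewrite [j == i]eq_sym (negPf hij) /=; ring.
have AQV i j : \sum_c eps c * ((i == t c)%:R - (j == t c)%:R) = 0.
  by apply: etrans (QV _ (Aroot_inV i j)); apply: eq_bigr => c _; rewrite AQ.
(* If [i] is missed, then [m j = 2] for every other [j]. Two such indices contradict [m2]. *)
have surj i : exists c, i = t c.
  apply: contrapT => hi.
  have ti c : (i == t c) = false by apply/eqP => h; apply: hi; exists c.
  have mi : m i = 0 by apply: big1 => c _; rewrite ti.
  have mj j : j != i -> m j = 2 by move/m2; rewrite mi addr0.
  have cardC : #|~: [set i]| = n by rewrite cardsC1 card_ord.
  have [n1|n1] := ltnP 1 n.
    have /card_gt1P[j [k [hj hk hjk]]] : (1 < #|~: [set i]|)%N by rewrite cardC.
    have := m2 _ _ hjk; rewrite !mj ?in_setC1 //; last 2 first.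
    - by rewrite !inE in hk.
    - by rewrite !inE in hj.
    lra.
  (* For n = 1 all signs are 1, so the image of a root would have coordinate sum 2 although it lies
     in V. *)
  have /card_gt0P[j] : (0 < #|~: [set i]|)%N by rewrite cardC.
  rewrite !inE => /mj; have <- : \sum_c eps c * ((j == t c)%:R - (i == t c)%:R) = m j.
    apply: eq_bigr => c _; rewrite ti subr0 /eps.
    case: (hte c).1 => [->|[_]]; first by rewrite mul1r.
    by rewrite ltnNge n1.
  by rewrite AQV => /eqP; rewrite eq_sym pnatr_eq0.
have [tau htau] := choice surj.
have tau_inj : injective tau by move=> i j h; rewrite (htau i) (htau j) h.
exists (perm tau_inj) => i j; rewrite !permE.
have ttau k c : (k == t c) = (c == tau k).
  apply/eqP/eqP => [h|->]; last exact: htau.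
  have /codomP[c' cc'] := inj_card_onto tau_inj (leqnn _) c.
  by rewrite h cc' -htau.
have sum_tau k : \sum_c eps c * (k == t c)%:R = eps (tau k).
  rewrite (bigD1 (tau k)) //= ttau eqxx mulr1 big1 ?addr0 // => c /negPf hc.
  by rewrite ttau hc mulr0.
(* The image of a root lies in V, so its two nonzero coordinates cancel. *)
have eps_eq : eps (tau i) = eps (tau j).
  apply/eqP; rewrite -subr_eq0 -!sum_tau -sumrB; apply/eqP.
  by apply: etrans (AQV i j); apply: eq_bigr => c _; rewrite mulrBr.
exists (eps (tau i)); first by rewrite -sqrf_eq0 eps2 oner_eq0.
apply/rowP => c; rewrite AQ mxE ArootE !ttau.
have [->|_] := eqVneq c (tau i); first by [].
have [->|_] := eqVneq c (tau j); first by rewrite eps_eq.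
by rewrite subrr !mulr0.
Qed.

(** The permutation [tau] follows the action of [Q] on all roots, so it carries edges to edges;
    invertibility of [Q] gives the converse. *)
Lemma isometric_isomorphic F G : (1 <= n)%N ->
  simplex_family F -> root_family F -> simplex_family G -> root_family G ->
  isometric F G -> isomorphic (assoc_graph F) (assoc_graph G).
Proof.
move=> hn sF rF sG rG [Q [oQ [s hQ]]]; have [QQ _] := oQ.
have [tau htau] := orthV_Aroot hn oQ (isometric_diff sF rF sG rG oQ hQ).
exists tau => i j; have [eta eta0 hA] := htau i j.
apply/asboolP/asboolP => -[hij [k [c hc]]].
  split; first by rewrite (inj_eq perm_inj).
  have [e [he hk]] := hQ k; exists (s k), (e * c * eta).
  have e2 : e * e = 1 by case: he => ->; ring.
  by rewrite -[G _]scale1r -e2 -scalerA -hk hc -scalemxAl hA !scalerA.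
split; first by rewrite (inj_eq perm_inj) in hij.
have [e [he hk]] := hQ (s^-1 k)%g; rewrite permKV hc in hk.
exists (s^-1 k)%g, (e * c * eta^-1).
rewrite -[LHS]mulmx1 -[RHS]mulmx1 -QQ !mulmxA hk -[in RHS]scalemxAl hA.
by rewrite !scalerA mulfVK.
Qed.

End RootFamilies.

Theorem theorem1 (R : realType) (n : nat) (hn : (1 <= n)%N) :
  [/\ (* realization: every family generating A_n is isometric to one
         whose normal vectors (normalized) lie in Delta(A_n) *)
      (forall F : 'I_n -> vec R n, simplex_family F -> generatesA F ->
         exists G, [/\ simplex_family G, root_family G & isometric F G]),
      (* well-definedness and injectivity *)
      (forall F G : 'I_n -> vec R n,
         simplex_family F -> root_family F -> generatesA F ->
         simplex_family G -> root_family G -> generatesA G ->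
         (isometric F G <-> isomorphic (assoc_graph F) (assoc_graph G))),
      (* the associated graph is a tree on n+1 vertices *)
      (forall F : 'I_n -> vec R n, simplex_family F -> root_family F -> generatesA F ->
         is_tree (assoc_graph F))
    & (* surjectivity onto trees with n+1 vertices *)
      (forall T : rel 'I_(n.+1), is_tree T ->
         exists F : 'I_n -> vec R n,
           [/\ simplex_family F, root_family F, generatesA F & isomorphic (assoc_graph F) T])].
Proof.
split.
- exact: realization.
- move=> F G sF rF _ sG rG _; split.
    exact: isometric_isomorphic.
  exact: isomorphic_isometric.
- by move=> F sF rF _; apply: assoc_graph_tree.
move=> T /(tree_realized R)[F [sF rF FT]]; exists F; split=> //.
  exact: simplex_root_generatesA.
by exists 1%g => x y; rewrite !perm1.
Qed.
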